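(* Let $n<\omega$, let $\mathcal{A}=(A,E_1,\dots,E_n)$ be a countable nested $n$-equivalence structure, let $E_0=A\times A$ and let $E_{n+1}$ be equality on $A$. Then $T_{\mathcal{A}}$ is weakly ultrahomogeneous in the predecessor representation if and only if $\mathcal{A}$ is weakly ultrahomogeneous.
   Context: An $n$-equivalence structure is a structure $(A,E_1,\dots,E_n)$ where each $E_i$ is an equivalence relation on $A$; it is nested if $E_j\subseteq E_i$ whenever $i<j\le n$. $[a]_i$ denotes the $E_i$ class of $a$. The tree $T_{\mathcal{A}}$ has as nodes the equivalence classes $[a]_i$ for $a\in A$ and $0\le i\le n+1$, where classes at different levels $i$ are regarded as distinct nodes even if equal as sets (i.e. nodes are pairs $(i,[a]_i)$). The root is $[a]_0=A$, and for each $a$ and each $i\le n$, $[a]_i$ is the predecessor of $[a]_{i+1}$; the root is its own predecessor. In the predecessor representation, $T_{\mathcal{A}}$ is the structure $(T_{\mathcal{A}},f)$ with $f$ the unary predecessor function. A structure $\mathcal{M}$ is weakly ultrahomogeneous if there is a finite set $\{a_1,\dots,a_m\}$ of its elements such that every isomorphism between finitely generated substructures of $\mathcal{M}$ containing all $a_i$ and fixing each $a_i$ extends to an automorphism of $\mathcal{M}$. *)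

(* Defs.v *)
From mathcomp Require Import all_boot all_classical.
From Corelib Require Import RelationClasses.

Set Implicit Arguments.
Unset Strict Implicit.
Unset Printing Implicit Defensive.

Local Open Scope classical_set_scope.

Record signature := Signature {
  fsym : Type;
  farity : fsym -> nat;
  rsym : Type;
  rarity : rsym -> nat }.

Record structure (L : signature) := Structure {
  carrier :> Type;
  fint : forall s : fsym L, (farity s).-tuple carrier -> carrier;
  rint : forall r : rsym L, (rarity r).-tuple carrier -> Prop }.

Arguments fint {L} M s t : rename.
Arguments rint {L} M r t : rename.

Definition tuple_in (T : Type) (k : nat) (t : k.-tuple T) (B : set T) : Prop :=
  forall i : 'I_k, B (tnth t i).

Definition substructure (L : signature) (M : structure L) (B : set M) : Prop :=
  forall (s : fsym L) (t : (farity s).-tuple M), tuple_in t B -> B (fint M s t).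

Definition finitely_generated (L : signature) (M : structure L) (B : set M) :
    Prop :=
  exists2 X : set M, finite_set X & B = smallest (@substructure L M) X.

(* Only the values of [h] on [B] matter: an isomorphism between the
   substructures [B] and [C] is represented by any of its extensions to a map
   [M -> M]. *)
Definition isomorphism (L : signature) (M : structure L) (B C : set M)
    (h : M -> M) : Prop :=
  [/\ set_bij B C h,
      forall (s : fsym L) (t : (farity s).-tuple M), tuple_in t B ->
        h (fint M s t) = fint M s (map_tuple h t)
    & forall (r : rsym L) (t : (rarity r).-tuple M), tuple_in t B ->
        (rint M r t <-> rint M r (map_tuple h t))].

Definition automorphism (L : signature) (M : structure L) (g : M -> M) : Prop :=
  isomorphism [set: M] [set: M] g.

Definition weakly_ultrahomogeneous (L : signature) (M : structure L) : Prop :=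
  exists2 P : set M, finite_set P &
    forall (B C : set M) (h : M -> M),
      finitely_generated B -> finitely_generated C ->
      P `<=` B -> P `<=` C ->
      isomorphism B C h -> (forall p, P p -> h p = p) ->
      exists2 g : M -> M, automorphism g & forall x, B x -> g x = h x.

(* The relations are indexed from 0: [eqv A k] is the relation E_(k+1). *)
Record equiv_structure (n : nat) := EquivStructure {
  eqv_sort :> Type;
  eqv : 'I_n -> eqv_sort -> eqv_sort -> Prop;
  eqv_equivalence : forall k, Equivalence (eqv k) }.

Arguments eqv {n} A k x y : rename.

Definition nested (n : nat) (A : equiv_structure n) : Prop :=
  forall i j : 'I_n, i < j -> forall x y : A, eqv A j x y -> eqv A i x y.

Definition equiv_signature (n : nat) : signature :=
  @Signature void (fun=> 0) 'I_n (fun=> 2).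

Definition equiv_to_structure (n : nat) (A : equiv_structure n) :
    structure (equiv_signature n) :=
  @Structure (equiv_signature n) A
    (fun (s : void) _ => match s with end)
    (fun (k : 'I_n) (t : 2.-tuple A) =>
       eqv A k (tnth t (inord 0)) (tnth t (inord 1))).

Section Tree.
Variables (n : nat) (A : equiv_structure n).

(* E_0 is the full relation, E_1, ..., E_n are the relations of [A], and
   E_(n+1) is equality; levels above n+1 are never used. *)
Definition level (i : nat) (x y : A) : Prop :=
  if i is j.+1 then
    if (insub j : option 'I_n) is Some k then eqv A k x y else x = y
  else True.

Definition eqclass (i : nat) (a : A) : set A := [set b | level i a b].

Definition node : Type :=
  {p : 'I_n.+2 * set A | exists a : A, p.2 = eqclass p.1 a}.

Definition mknode (i : 'I_n.+2) (a : A) : node :=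
  exist _ (i, eqclass i a) (ex_intro _ a erefl).

Definition node_level (v : node) : 'I_n.+2 := (sval v).1.

Definition node_repr (v : node) : A := projT1 (cid (svalP v)).

(* This does not depend on the representative when [A] is nested: see
   [predecessor_mknode]. *)
Definition predecessor (v : node) : node :=
  mknode (inord (node_level v).-1) (node_repr v).

Definition tree_signature : signature :=
  @Signature unit (fun=> 1) void (fun=> 0).

Definition tree : structure tree_signature :=
  @Structure tree_signature node
    (fun (_ : unit) (t : 1.-tuple node) => predecessor (thead t))
    (fun (r : void) _ => match r with end).

Lemma level_eqv (k : 'I_n) (x y : A) : level k.+1 x y = eqv A k x y.
Proof.
rewrite /level; case: (insubP 'I_n (k : nat)) => [l _ /val_inj -> //|].
by rewrite ltn_ord.
Qed.

Lemma level_last (x y : A) : level n.+1 x y = (x = y).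
Proof.
by rewrite /level; case: (insubP 'I_n n) => // l; rewrite ltnn.
Qed.

Lemma level_equivalence (i : nat) : Equivalence (level i).
Proof.
rewrite /level; case: i => [|j]; first by split.
by case: (insub j) => [k|]; [apply: eqv_equivalence|apply: eq_equivalence].
Qed.

Lemma level_nested (i : nat) (x y : A) :
  nested A -> level i.+1 x y -> level i x y.
Proof.
move=> nA; case: i => // i; rewrite /level.
case: (insubP 'I_n i.+1) => [k _ ki|_ ->].
  case: (insubP 'I_n i) => [l _ li|].
    by apply: nA; rewrite -ltnS -li in ki *; rewrite ki.
  by rewrite ltnW // -ki ltn_ord.
by case: (insubP 'I_n i) => // l _ _; case: (@eqv_equivalence n A l).
Qed.

Lemma eq_eqclass (i : nat) (x y : A) : level i x y -> eqclass i x = eqclass i y.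
Proof.
have [_ sy tr] := level_equivalence i.
by move=> xy; apply/seteqP; split=> z /= ?; apply: tr; eauto.
Qed.

Lemma eq_mknode (i : 'I_n.+2) (x y : A) : level i x y -> mknode i x = mknode i y.
Proof. by move=> xy; apply: eq_exist => /=; rewrite (eq_eqclass xy). Qed.

Lemma predecessor_root (a : A) : predecessor (mknode ord0 a) = mknode ord0 a.
Proof.
rewrite /predecessor /= (_ : inord 0 = ord0); last exact/val_inj/inordK.
exact: eq_mknode.
Qed.

Lemma predecessor_mknode (i : 'I_n.+1) (a : A) : nested A ->
  predecessor (mknode (lift ord0 i) a) = mknode (widen_ord (leqnSn _) i) a.
Proof.
move=> nA; rewrite /predecessor /node_repr; case: cid => b /= ab.
rewrite !add0n in ab *.
have -> : inord i = widen_ord (leqnSn _) i :> 'I_n.+2.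
  by apply: val_inj; rewrite /= inordK // ltnW // ltnS.
apply: eq_mknode; apply: level_nested => //=.
have [re sy _] := level_equivalence i.+1; apply: sy.
have : eqclass i.+1 b b by exact: re.
by rewrite -ab.
Qed.

End Tree.

(* Main.v *)
Require Import Defs.
From mathcomp Require Import all_boot all_classical.

(** A point [a] of [A] is a leaf of the tree, and the nodes [mknode i a] are
    its ancestors; two points are related at level [i] exactly when their
    ancestors at level [i] coincide ([mknode_eqP]).  Levels are definable from
    the predecessor function, because the root is its only fixed point, so an
    isomorphism between subtrees preserves them ([isomorphism_node_level]).

    If the tree is weakly ultrahomogeneous over [P], then [A] is so over a set
    of representatives of the nodes in [P].  A finite partial isomorphism [h]
    of [A] acts on the ancestors of the points of its domain
    ([subtree_isomorphism]); an automorphism of the tree that extends this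
    action permutes the leaves, which gives an automorphism of [A]
    ([leaf_automorphism]), and this one extends [h].

    If [A] is weakly ultrahomogeneous over [P], then the tree is so over the
    set of ancestors of points of [P].  Let [h] be an isomorphism from a finite
    subtree [B] onto a finite subtree [C].  The subtree [B] may stop above the
    leaves, at nodes [v] such that nothing is known about what lies below [v]
    and below [h v].  Such a tip has no child in [B], so it suffices to choose
    one point below each tip [v] and send it to any point below [h v]: two
    distinct chosen points are related exactly at those levels where their tips have
    a common ancestor in [B] ([level_tips]), and [h] preserves this.  The
    resulting finite partial isomorphism of [A] extends to an automorphism,
    whose action on the tree agrees with [h] at the tips, and therefore at all
    nodes of [B], since each lies above a tip ([above_tip]). *)

Local Open Scope classical_set_scope.

Section Generalities.
Set Implicit Arguments.
Unset Strict Implicit.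

Lemma finite_substructure_fg (L : signature) (M : structure L) (B : set M) :
  finite_set B -> substructure B -> finitely_generated B.
Proof.
move=> fB sB; exists B => //; apply/seteqP; split; first exact: sub_smallest.
exact: smallest_sub.
Qed.

Lemma substructure_generated (L : signature) (M : structure L) (X : set M) :
  substructure (smallest (@substructure L M) X).
Proof.
move=> s t tX B [sB XB]; apply: (sB) => i; exact: (tX i B (conj sB XB)).
Qed.

(** The map [f i |-> g i] is well defined and injective as soon as [f] and [g]
    identify the same indices. *)
Lemma map_between_images (I X : Type) (D : set I) (f g : I -> X) :
  (forall i j, D i -> D j -> (f i = f j <-> g i = g j)) ->
  exists2 h : X -> X,
    set_bij (f @` D) (g @` D) h & forall i, D i -> h (f i) = g i.
Proof.
move=> fg.
pose h x := if pselect (exists2 i, D i & f i = x) is left e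
            then g (projT1 (cid2 e)) else x.
have hE i : D i -> h (f i) = g i.
  move=> Di; rewrite /h; case: pselect => [e|[]]; last by exists i.
  by case: cid2 => j Dj /= fji; apply/(fg j i Dj Di).
exists h => //; split.
- by move=> _ [i Di <-]; exists i => //; rewrite hE.
- move=> x y /set_mem[i Di <-] /set_mem[j Dj <-].
  by rewrite !hE // => /(fg i j Di Dj).
- by move=> _ [i Di <-]; exists (f i); [exists i|exact: hE].
Qed.

End Generalities.

(** * Nodes, levels and ancestors *)

Section Nodes.
Set Implicit Arguments.
Unset Strict Implicit.
Variables (n : nat) (A : equiv_structure n).
Implicit Types (i : 'I_n.+2) (v w : node A) (a x y : A).

Lemma mknode_eqP i x y : mknode i x = mknode i y <-> level i x y.
Proof.
split=> [xy|]; last exact: eq_mknode.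
have : eqclass i y y by case: (level_equivalence A i) => + _ _; apply.
have -> : eqclass i y = (sval (mknode i y)).2 by [].
by rewrite -xy.
Qed.

Lemma node_reprK v : mknode (node_level v) (node_repr v) = v.
Proof.
rewrite /node_repr; case: cid => a /=; case: v => [[i S] ea] /= eS.
by apply: eq_exist; rewrite [S in RHS]eS.
Qed.

Lemma mknode_max_inj : injective (@mknode n A ord_max).
Proof. by move=> x y /mknode_eqP; rewrite level_last. Qed.

Lemma node_repr_max a : node_repr (mknode ord_max a) = a.
Proof. by apply: mknode_max_inj; exact: (node_reprK (mknode ord_max a)). Qed.

Lemma node_level_predecessor v :
  node_level (predecessor v) = (node_level v).-1 :> nat.
Proof.
by rewrite /= inordK // (leq_ltn_trans (leq_pred _)).
Qed.

Lemma node_level_iter k v :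
  node_level (iter k (@predecessor n A) v) = node_level v - k :> nat.
Proof.
elim: k => [|k IH]; first by rewrite subn0.
by rewrite iterS node_level_predecessor IH subnS.
Qed.

Lemma predecessor_fixedP v : predecessor v = v <-> node_level v = 0 :> nat.
Proof.
split=> [vv|v0].
  have := node_level_predecessor v; rewrite vv.
  by case: nat_of_ord => // m /esym/n_Sn.
rewrite -[v]node_reprK (_ : node_level v = ord0) ?predecessor_root //.
exact: val_inj.
Qed.

Hypothesis A_nested : nested A.

Lemma predecessorE i a : predecessor (mknode i a) = mknode (inord i.-1) a.
Proof.
case: (unliftP ord0 i) => [j|] ->; last first.
  by rewrite predecessor_root; congr mknode; apply/val_inj; rewrite /= inordK.
rewrite predecessor_mknode //; congr mknode.
by apply/val_inj; rewrite /= inordK // ltnW // ltnS ltn_ord.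
Qed.

Lemma iter_predecessor k i a :
  iter k (@predecessor n A) (mknode i a) = mknode (inord (i - k)) a.
Proof.
elim: k => [|k IH]; first by rewrite subn0 inord_val.
rewrite iterS IH predecessorE subnS inordK //.
exact: leq_ltn_trans (leq_subr _ _) (ltn_ord _).
Qed.

Lemma iter_predecessor_repr i v : i <= node_level v ->
  iter (node_level v - i) (@predecessor n A) v = mknode i (node_repr v).
Proof.
by move=> iv; rewrite -{2}[v]node_reprK iter_predecessor subKn // inord_val.
Qed.

(** The node at level [i] above a point is obtained from its leaf by a number
    of steps that depends only on [i]. *)
Lemma level_leafP i x y :
  level i x y <->
  iter (n.+1 - i) (@predecessor n A) (mknode ord_max x) =
  iter (n.+1 - i) (@predecessor n A) (mknode ord_max y).
Proof.
by rewrite !iter_predecessor /= subKn -1?ltnS // inord_val mknode_eqP.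
Qed.

End Nodes.

(** * Substructures and isomorphisms *)

Section Isomorphisms.
Set Implicit Arguments.
Unset Strict Implicit.
Variables (n : nat) (A : equiv_structure n).

Lemma tree_substructureP (B : set (tree A)) :
  substructure B <-> forall v : node A, B v -> B (predecessor v).
Proof.
split=> [sB v Bv|sB s t tB]; last by apply: sB; exact: tB.
by apply: (sB tt [tuple v]) => i; rewrite (ord1 i).
Qed.

Lemma iter_predecessor_in (B : set (tree A)) k (v : node A) :
  substructure B -> B v -> B (iter k (@predecessor n A) v).
Proof.
move=> /tree_substructureP sB Bv; elim: k => //= k; exact: sB.
Qed.

Lemma tree_isomorphismP (B C : set (tree A)) (h : tree A -> tree A) :
  isomorphism B C h <->
  set_bij B C h /\
  forall v : node A, B v -> h (predecessor v) = predecessor (h v).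
Proof.
split=> [[bh fh _]|[bh fh]]; split=> //.
- move=> v Bv; have := fh tt [tuple v]; apply=> i; by rewrite (ord1 i).
- move=> s t tB; have /fh : B (thead t) by exact: tB.
  by rewrite /= /thead tnth_map.
Qed.

Lemma equiv_substructure (B : set (equiv_to_structure A)) : substructure B.
Proof. by case. Qed.

Lemma equiv_fg_finite (B : set (equiv_to_structure A)) :
  finitely_generated B -> finite_set B.
Proof.
move=> [X fX ->]; rewrite (_ : smallest _ _ = X) //; apply/seteqP; split.
- apply: smallest_sub => //; exact: equiv_substructure.
- exact: sub_smallest.
Qed.

(** Levels [0] and [n.+1] are the full relation and equality, which every
    bijection preserves. *)
Lemma equiv_isomorphismP (B C : set (equiv_to_structure A))
    (h : equiv_to_structure A -> equiv_to_structure A) :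
  isomorphism B C h <->
  set_bij B C h /\
  forall (i : 'I_n.+2) (x y : A), B x -> B y ->
    (level i x y <-> level i (h x) (h y)).
Proof.
split=> [[bh _ rh]|[bh lh]]; split=> //.
- case=> -[|k] // kn x y Bx By; case: (ltnP k n) => [k_n|n_k].
    have := rh (Ordinal k_n) [tuple x; y].
    rewrite /= !(tnth_nth x) /= !inordK //=.
    rewrite -!(level_eqv (Ordinal k_n)); apply.
    by move=> -[[|[|//]] ?].
  have -> : nat_of_ord (Ordinal kn) = n.+1.
    by apply/eqP; rewrite eqn_leq; apply/andP; split.
  rewrite !level_last; split=> [->//|]; case: bh => _ ih _.
  by apply: ih; apply/mem_set.
- move=> k t tB; rewrite /= !tnth_map -!level_eqv.
  have kn : (k : 'I_n).+1 < n.+2 by exact/leqW/ltn_ord.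
  exact: (lh (Ordinal kn) _ _ (tB _) (tB _)).
Qed.

Lemma isomorphism_iter (B C : set (tree A)) h k (v : node A) :
  substructure B -> isomorphism B C h -> B v ->
  h (iter k (@predecessor n A) v) = iter k (@predecessor n A) (h v).
Proof.
move=> sB /tree_isomorphismP[_ fh] Bv; elim: k => //= k IH.
by rewrite fh ?IH //; exact: iter_predecessor_in.
Qed.

Lemma isomorphism_inj (L : signature) (M : structure L) (B C : set M) h x y :
  isomorphism B C h -> B x -> B y -> h x = h y -> x = y.
Proof. by move=> [[_ ih _] _ _] Bx By; apply: ih; apply/mem_set. Qed.

(** The level of a node is the number of predecessor steps up to the root,
    the only fixed point; an isomorphism preserves steps and fixed points. *)
Lemma isomorphism_node_level (B C : set (tree A)) h (v : node A) :
  substructure B -> isomorphism B C h -> B v ->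
  node_level (h v : node A) = node_level v.
Proof.
move=> sB iso Bv; apply/val_inj => /=.
have E k : (node_level v - k == 0) = (node_level (h v : node A) - k == 0).
  have Bk : B (iter k (@predecessor n A) v) by exact: iter_predecessor_in.
  rewrite -!node_level_iter -(isomorphism_iter _ sB iso) //.
  have /tree_isomorphismP[_ /(_ _ Bk) hk] := iso.
  apply/eqP/eqP => /predecessor_fixedP e; apply/predecessor_fixedP.
    by rewrite -hk e.
  apply: (isomorphism_inj iso); [|exact: Bk|by rewrite hk].
  exact: (iter_predecessor_in k.+1).
by apply/eqP; rewrite eqn_leq -!subn_eq0 -E subnn eqxx E subnn.
Qed.

End Isomorphisms.

(** * From points to nodes and back *)

Section Subtree.
Set Implicit Arguments.
Unset Strict Implicit.
Variables (n : nat) (A : equiv_structure n).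
Hypothesis A_nested : nested A.

Definition subtree (B : set A) : set (tree A) :=
  (fun p => mknode p.1 p.2) @` ([set: 'I_n.+2] `*` B).

Lemma subtree_mknode (B : set A) i a : B a -> subtree B (mknode i a).
Proof. by exists (i, a). Qed.

Lemma subtree_repr (X : set (tree A)) : X `<=` subtree (@node_repr n A @` X).
Proof.
by move=> v Xv; rewrite -[v]node_reprK; apply: subtree_mknode; exists v.
Qed.

Lemma finite_subtree (B : set A) : finite_set B -> finite_set (subtree B).
Proof. by move=> fB; apply/finite_image/finite_setX. Qed.

Lemma substructure_subtree (B : set A) : substructure (subtree B).
Proof.
apply/tree_substructureP => _ [[i a] [_ /= Ba] <-].
by rewrite predecessorE //; exact: subtree_mknode.
Qed.

Lemma subtree_fg (B : set A) : finite_set B -> finitely_generated (subtree B).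
Proof.
move=> /finite_subtree fB; apply: finite_substructure_fg => //.
exact: substructure_subtree.
Qed.

Lemma tree_fg_finite (B : set (tree A)) : finitely_generated B -> finite_set B.
Proof.
move=> [X fX ->]; apply: (@sub_finite_set _ _ (subtree (@node_repr n A @` X))).
  apply: smallest_sub; [exact: substructure_subtree|exact: subtree_repr].
exact/finite_subtree/finite_image.
Qed.

(** Relatedness at level [i] is equality of nodes at level [i], so a map that
    preserves all levels acts on nodes, and this action commutes with the
    predecessor. *)
Lemma subtree_isomorphism (B C : set (equiv_to_structure A)) h :
  isomorphism B C h ->
  exists2 H : tree A -> tree A, isomorphism (subtree B) (subtree C) H
    & forall i (a : A), B a -> H (mknode i a) = mknode i (h a : A).
Proof.
move=> /equiv_isomorphismP[[hBC _ hs] lh].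
pose f (p : 'I_n.+2 * A) := mknode p.1 p.2.
pose g (p : 'I_n.+2 * A) := mknode p.1 (h p.2 : A).
have fg p q : ([set: 'I_n.+2] `*` B) p -> ([set: 'I_n.+2] `*` B) q ->
    (f p = f q <-> g p = g q).
  case: p q => [i x] [j y] [_ /= Bx] [_ /= By]; rewrite /f /g /=.
  split=> E; have Eij : i = j := congr1 (@node_level n A) E;
    rewrite -{}Eij in E *; apply/mknode_eqP; apply/(lh i x y Bx By);
    exact/mknode_eqP.
have [H bH HE] := map_between_images fg.
have Hmk i (a : A) : B a -> H (mknode i a) = mknode i (h a : A).
  by move=> Ba; rewrite (HE (i, a)).
exists H => //; apply/tree_isomorphismP; split.
  have <- : g @` ([set: 'I_n.+2] `*` B) = subtree C; last exact: bH.
  apply/seteqP; split=> [_ [[i a] [_ Ba] <-]|_ [[i c] [_ /= Cc] <-]].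
    by apply: subtree_mknode; exact: hBC.
  by have [b Bb <-] := hs _ Cc; exists (i, b).
move=> _ [[i a] [_ /= Ba] <-].
by rewrite predecessorE // !Hmk // predecessorE.
Qed.

Lemma subtree_setT : subtree [set: A] = [set: tree A].
Proof.
by apply/seteqP; split=> // v _; rewrite -[v]node_reprK; exact: subtree_mknode.
Qed.

(** An automorphism of the tree permutes the leaves, and the relations of [A]
    are equalities between iterated predecessors of leaves. *)
Lemma leaf_automorphism (g : tree A -> tree A) : automorphism g ->
  exists2 g' : equiv_to_structure A -> equiv_to_structure A,
    automorphism g' &
    forall a : A, mknode ord_max (g' a : A) = g (mknode ord_max a).
Proof.
move=> iso; have sT : substructure [set: tree A] by [].
pose g' (a : equiv_to_structure A) : equiv_to_structure A :=
  node_repr (g (mknode ord_max a) : node A).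
have g'E (a : A) : mknode ord_max (g' a : A) = g (mknode ord_max a).
  have := node_reprK (g (mknode ord_max a) : node A).
  by rewrite (isomorphism_node_level sT iso).
exists g' => //; apply/equiv_isomorphismP; split; last first.
  move=> i x y _ _; rewrite !level_leafP // !g'E.
  rewrite -!(isomorphism_iter _ sT iso) //; split=> [->//|].
  exact: (isomorphism_inj iso).
split=> // [x y _ _ xy|a _].
  apply/(@mknode_max_inj n A)/(isomorphism_inj iso) => //; by rewrite -!g'E xy.
have [[_ _ sg] _ _] := iso; have [v _ gv] := sg (mknode ord_max a) I.
exists (node_repr v) => //; apply: (@mknode_max_inj n A).
rewrite g'E -gv; congr g; rewrite -{2}[v]node_reprK; congr mknode.
by rewrite -(isomorphism_node_level sT iso) // gv.
Qed.

End Subtree.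

(** * Tips of a subtree *)

Section Tips.
Set Implicit Arguments.
Unset Strict Implicit.
Variables (n : nat) (A : equiv_structure n).
Hypothesis A_nested : nested A.

(** A node without children in [B]; the equation [w = v] allows for the root,
    which is its own predecessor. *)
Definition tips (B : set (tree A)) : set (tree A) :=
  [set v | B v /\ forall w, B w -> predecessor w = v -> w = v].

Lemma tip_below (B : set (tree A)) (v w : node A) k : substructure B ->
  tips B v -> B w -> iter k (@predecessor n A) w = v -> w = v.
Proof.
move=> sB [_ tv] Bw; elim: k => //= k IH /tv e; apply/IH/e.
exact: iter_predecessor_in.
Qed.

Lemma leaf_tip (B : set (tree A)) (a : A) :
  B (mknode ord_max a) -> tips B (mknode ord_max a).
Proof.
split=> // w _ pw; have := node_level_predecessor w; rewrite pw /=.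
(* A child of a node at level [n.+1] would have level [n.+2]. *)
have := ltn_ord (node_level w); case: (nat_of_ord _) => //= m + E.
by rewrite -E ltnn.
Qed.

(** Climbing away from the root inside [B] must stop, since levels are
    bounded. *)
Lemma above_tip (B : set (tree A)) (v : node A) : B v ->
  exists2 w, tips B w & exists k, v = iter k (@predecessor n A) w.
Proof.
have [m] := ubnP (n.+2 - node_level v); elim: m v => // m IH v mv Bv.
have [[w [Bw [wv nwv]]]|none] :=
    pselect (exists w : node A, B w /\ predecessor w = v /\ w <> v); last first.
  exists v; last by exists 0.
  split=> // w Bw wv; apply: contrapT => nwv; apply: none; by exists w.
have lw : 0 < node_level w.
  rewrite lt0n; apply/eqP => /predecessor_fixedP E; apply: nwv; by rewrite -wv.
have lv : (node_level v).+1 = node_level w.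
  by rewrite -wv node_level_predecessor prednK.
have wm : n.+2 - node_level w < m.
  by rewrite -ltnS (leq_trans _ mv) // -lv ltnS ltn_sub2l.
have [u tu [k ek]] := IH w wm Bw.
by exists u => //; exists k.+1; rewrite iterS -ek.
Qed.

(** If two points are related at a level deeper than one of their tips, then
    this tip lies above the other one, hence equals it. *)
Lemma level_tips (B : set (tree A)) (v w : node A) (i : 'I_n.+2) :
  substructure B -> tips B v -> tips B w ->
  level i (node_repr v) (node_repr w) <->
  v = w \/ [/\ i <= node_level v, i <= node_level w &
    iter (node_level v - i) (@predecessor n A) v =
    iter (node_level w - i) (@predecessor n A) w].
Proof.
move=> sB; wlog le_vw : v w / node_level v <= node_level w => [sym|] tv tw.
  have [|/ltnW] := leqP (node_level v) (node_level w); first by move/sym; exact.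
  move=> /sym/(_ tw tv) [to from]; have [r s _] := level_equivalence A i.
  split=> [/s/to|[->|[iv iw E]]]; [|exact: r|].
    by case=> [->|[]]; [left|right].
  by apply/s/from; right.
split=> [lvw|[->|[iv iw]]]; last 2 first.
- by case: (level_equivalence A i).
- by rewrite !iter_predecessor_repr // => /mknode_eqP.
have [iv|vi] := leqP i (node_level v).
  right; split=> //; first exact: leq_trans le_vw.
  rewrite !iter_predecessor_repr //; first exact/mknode_eqP.
  exact: leq_trans le_vw.
left; apply/esym/(@tip_below B _ _ (node_level w - node_level v)) => //.
  by case: tw.
rewrite iter_predecessor_repr // -{2}[v]node_reprK.
have /(congr1 (iter (i - node_level v) (@predecessor n A))) :
  mknode i (node_repr v) = mknode i (node_repr w) by exact/mknode_eqP.
rewrite !iter_predecessor // subKn 1?ltnW // inord_val; exact: esym.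
Qed.

Lemma isomorphism_tips (B C : set (tree A)) h (v : tree A) :
  substructure B -> isomorphism B C h -> tips B v -> tips C (h v).
Proof.
move=> /tree_substructureP sB iso [Bv tv].
have [[hBC _ sh] _ _] := iso; have /tree_isomorphismP[_ fh] := iso.
split=> [|w Cw]; first exact: hBC.
have [u Bu <-] := sh _ Cw; rewrite -fh // => /(isomorphism_inj iso) E.
by congr h; apply: tv => //; apply: E => //; exact: sB.
Qed.

(** A subtree isomorphism [h] matches the point chosen below a tip [v] with the
    one chosen below [h v]. *)
Lemma tips_isomorphism (B C : set (tree A)) h :
  substructure B -> substructure C -> isomorphism B C h ->
  exists2 h' : equiv_to_structure A -> equiv_to_structure A,
    @isomorphism _ (equiv_to_structure A) (@node_repr n A @` tips B)
      ((fun v => node_repr (h v : node A)) @` tips B) h'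
    & forall v, tips B v -> h' (node_repr v) = node_repr (h v : node A).
Proof.
move=> sB sC iso.
have iso_level (v : node A) : tips B v ->
    node_level (h v : node A) = node_level v.
  by move=> [Bv _]; rewrite (isomorphism_node_level sB iso).
have lev (i : 'I_n.+2) v w : tips B v -> tips B w ->
    level i (node_repr v) (node_repr w) <->
    level i (node_repr (h v : node A)) (node_repr (h w : node A)).
  move=> tv tw; have [[Bv _] [Bw _]] := (tv, tw).
  rewrite (level_tips _ sB tv tw).
  have [htv htw] := (isomorphism_tips sB iso tv, isomorphism_tips sB iso tw).
  rewrite (level_tips _ sC htv htw).
  rewrite !iso_level // -!(isomorphism_iter _ sB iso) //.
  split=> [[->|[? ? E]]|[/(isomorphism_inj iso) E|[? ? E]]].
  - by left.
  - by right; rewrite E.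
  - by left; exact: E.
  - right; split=> //; apply: (isomorphism_inj iso _ _ E);
      exact: iter_predecessor_in.
have [v w tv tw|h' bh h'E] := @map_between_images _ (equiv_to_structure A)
    (tips B) (@node_repr n A) (fun v => node_repr (h v : node A)).
  by have := lev ord_max v w tv tw; rewrite !level_last.
exists h' => //; apply/equiv_isomorphismP; split=> //.
by move=> i _ _ [v tv <-] [w tw <-]; rewrite !h'E //; exact: lev.
Qed.

End Tips.

Theorem theorem8p6 (n : nat) (A : equiv_structure n)
    (A_countable : countable [set: A]) (A_nested : nested A) :
  weakly_ultrahomogeneous (tree A) <->
  weakly_ultrahomogeneous (equiv_to_structure A).
Proof.
split=> [[P fP uhP]|[P fP uhP]].
  exists (@node_repr n A @` P); first exact: finite_image.
  move=> B C h /equiv_fg_finite fB /equiv_fg_finite fC PB PC iso hP.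
  have P_sub (D : set A) : @node_repr n A @` P `<=` D -> P `<=` subtree D.
    move=> PD v Pv; rewrite -[v]node_reprK; apply: subtree_mknode.
    by apply: PD; exists v.
  have [H isoH HE] := subtree_isomorphism A_nested iso.
  have HP v : P v -> H v = v.
    move=> Pv; rewrite -[v]node_reprK HE; last by apply: PB; exists v.
    by rewrite hP //; exists v.
  have [G autG GH] := uhP _ _ H
    (subtree_fg A_nested fB) (subtree_fg A_nested fC)
    (P_sub _ PB) (P_sub _ PC) isoH HP.
  have [g autg gE] := leaf_automorphism A_nested autG.
  exists g => // b Bb; apply: (@mknode_max_inj n A).
  by rewrite gE GH ?HE //; exact: subtree_mknode.
exists (subtree P); first exact: finite_subtree.
move=> B C h fgB fgC PB PC iso hP.
have sB : substructure B by case: fgB => X _ ->; exact: substructure_generated.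
have sC : substructure C by case: fgC => X _ ->; exact: substructure_generated.
have fB := tree_fg_finite A_nested fgB.
have ftips : finite_set (tips B) by apply: sub_finite_set fB => v [].
have [h' iso' h'E] := tips_isomorphism A_nested sB sC iso.
have Pleaf (p : A) : P p -> subtree P (mknode ord_max p).
  exact: subtree_mknode.
have Ptip (p : A) : P p -> tips B (mknode ord_max p).
  by move=> Pp; apply/leaf_tip/PB/Pleaf.
have h'P (p : A) : P p -> h' p = p.
  move=> Pp; rewrite -{1}[p]node_repr_max h'E; last exact: Ptip.
  by rewrite hP ?node_repr_max //; exact: Pleaf.
have equiv_fg (D : set (equiv_to_structure A)) :
    finite_set D -> finitely_generated D.
  by move=> fD; exact: (finite_substructure_fg fD (@equiv_substructure _ _ D)).
have [|p Pp|g autg gh'] := uhP _ _ h' (equiv_fg _ (finite_image _ ftips))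
    (equiv_fg _ (finite_image _ ftips)) _ _ iso' h'P.
- move=> p Pp; exists (mknode ord_max p); first exact: Ptip.
  exact: node_repr_max.
- exists (mknode ord_max p); first exact: Ptip.
  by rewrite hP ?node_repr_max //; exact: Pleaf.
have [G autG GE] := subtree_isomorphism A_nested autg.
rewrite subtree_setT in autG.
exists G => // v /(above_tip)[w tw [k ->]]; have [Bw _] := tw.
rewrite (isomorphism_iter _ _ autG) // (isomorphism_iter _ sB iso) //.
congr iter; rewrite -[w]node_reprK GE // gh'; last by exists w.
rewrite h'E // node_reprK -(isomorphism_node_level sB iso) //.
exact: node_reprK.
Qed.
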